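(* Let $\theta^*>0$ and let $n\in\mathbb N$. Consider any pairing coupling procedure on $[n]$ with parameter $\theta^*$ (as defined in the context), and let $F$ be the event that the coupling is not successful. Then $$ \mathbb P[F]\ \ge\ \prod_{i=1}^{\lfloor n/2\rfloor}\Bigl(1-\tfrac12\min\{\theta^*/i,\,1/e\}\Bigr). $$ Moreover, for fixed $\theta^*>0$, the right-hand side satisfies $$ \prod_{i=1}^{\lfloor n/2\rfloor}\Bigl(1-\tfrac12\min\{\theta^*/i,\,1/e\}\Bigr)\ \asymp\ n^{-\theta^*/2}\qquad\text{as } n\to\infty . $$
   Context: Notation: $[n]=\{1,2,\dots,n\}$; $\lfloor x\rfloor$ is the integer part of $x$; $I[\cdot]$ is an indicator. For positive sequences, $f(n)\asymp g(n)$ means that there are constants $0<c\le C<\infty$, depending only on $\theta^*$, with $c\,g(n)\le f(n)\le C\,g(n)$ for all sufficiently large $n$. Background. Let $Z_j\sim\mathrm{Po}(\theta^*/j)$, $j\ge1$, be independent Poisson random variables. The procedure below is used to couple two copies of $\sum_{j=1}^n jZ_j$, one of which is shifted by $1$. It processes disjoint pairs of indices from $[n]$ one after another. For a pair $j<j+k+1$, copies $X'=jZ_j'+(j+k+1)Z_{j+k+1}'$ and $X''=jZ_j''+(j+k+1)Z_{j+k+1}''$ of the same random variable are coupled so that $X'-X''\in\{-(k+1),0,k+1\}$. Each of the two non-zero values (a ''jump'') is taken with probability $\tfrac12 p(j,j+k+1)$, where $$ p(m_1,m_2):=2e^{-\theta^*/m_1}\,\frac{\theta^*}{m_2}\,e^{-\theta^*/m_2},\qquad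 m_1<m_2 . $$ Definition (pairing coupling procedure on $[n]$ with parameter $\theta^*$). Let $U_1,U_2,\dots$ be independent random variables uniform on $[0,1]$. Let $J_1,J_2,\dots$ be independent Bernoulli random variables with $\mathbb P[J_i=1]=\mathbb P[J_i=0]=\tfrac12$, independent of the $U_i$. The procedure has a state $\widetilde V_i$, with $\widetilde V_0=0$. At step $i\ge1$, if success has not yet occurred, it selects a suitable pair of indices $M_{i1}<M_{i2}$ in $[n]$. A pair is suitable if neither index has been used in an earlier step and $M_{i2}-M_{i1}=\widetilde V_{i-1}+1$. The selection is given by an arbitrary (measurable) rule that may depend on $\bigl((M_{j1},M_{j2},U_j),\,1\le j<i\bigr)$. Then put $$ Y_i:=I[U_i\le p(M_{i1},M_{i2})], $$ the indicator that a jump occurs at step $i$: - If $Y_i=0$, then $\widetilde V_i=\widetilde V_{i-1}$. - If $Y_i=1$ and $J_i=1$, then the jump is $-(\widetilde V_{i-1}+1)$, so that $\widetilde V_i=-1$. The coupling is then successful and the procedure stops. - If $Y_i=1$ and $J_i=0$, then the jump is $+(\widetilde V_{i-1}+1)$, so that $\widetilde V_i=2\widetilde V_{i-1}+1$. (Thus, before success, all jumps so far have been upward and $\widetilde V_{i-1}+1=2^{\sum_{j<i}Y_j}$, so the required difference is determined by the past pairs and the past $U_j$.) If success has not occurred and no suitable pair of unused indices in $[n]$ remains, then the procedure stops and the coupling is not successful. The event $F$ that the coupling is not successful is the event that $Y_iJ_i=0$ for every step $i$ that is carried out. *)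

(* Defs.v *)
From HB Require Import structures.
From mathcomp Require Export all_boot all_order all_algebra finmap.
From mathcomp Require Export all_classical all_reals all_analysis.

Set Implicit Arguments.
Unset Strict Implicit.
Unset Printing Implicit Defensive.

Export Order.TTheory GRing.Theory Num.Theory.
Export numFieldNormedType.Exports.

Local Open Scope classical_set_scope.
Local Open Scope ring_scope.

(* Mutual independence of a family of classes of events; for random variables
   it is applied to the sigma-algebras that they generate. *)
Definition mutually_independent d (T : measurableType d) (R : realType)
    (P : probability T R) (I : choiceType) (E : I -> set (set T)) : Prop :=
  forall (D : {fset I}) (A : I -> set T),
    (forall i, i \in D -> E i (A i)) ->
    P (\bigcap_(i in [set` D]) A i) = (\prod_(i <- D) P (A i))%E.

Definition asymp (R : realType) (f g : nat -> R) : Prop :=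
  exists c C : R, [/\ 0 < c, c <= C &
    \forall n \near \oo, c * g n <= f n <= C * g n].

(* Joint mutual independence of both sequences, hence the index type
   [nat + nat]. *)
Definition jointly_independent d (T : measurableType d) (R : realType)
    (P : probability T R) (U : nat -> {RV P >-> R})
    (J : nat -> {RV P >-> bool}) : Prop :=
  mutually_independent P (fun k : nat + nat =>
    match k with
    | inl i => g_sigma_algebra_preimage (U i)
    | inr i => g_sigma_algebra_preimage (J i)
    end).

Section Procedure.
Variables (R : realType) (theta : R) (n : nat).

Definition jump_prob (m1 m2 : nat) : R :=
  2 * expR (- (theta / m1%:R)) * (theta / m2%:R) * expR (- (theta / m2%:R)).

(* A past step is recorded as ((M_1, M_2), U). *)
Definition history : Type := seq (nat * nat * R).

Definition used (h : history) : seq nat :=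
  flatten [seq [:: x.1.1; x.1.2] | x <- h].

(* Steps are numbered from 0: [past] lists the steps carried out so far, in
   chronological order, and [shift] is the current value of V, which is
   nonnegative until the coupling succeeds and -1 afterwards. *)
Record state : Type := State { past : history; shift : int }.

Definition suitable (s : state) (m1 m2 : nat) : bool :=
  [&& (1 <= m1)%N, (m1 < m2)%N, (m2 <= n)%N,
      m1 \notin used (past s), m2 \notin used (past s)
    & m2%:Z - m1%:Z == shift s + 1].

Definition running (s : state) : bool :=
  (shift s != -1) &&
  [exists m1 : 'I_n.+1, exists m2 : 'I_n.+1, suitable s m1 m2].

Variable rule : history -> nat * nat.

(* The indicator Y of a jump at the step made from state [s] with uniform
   variate [u]. *)
Definition jumps (s : state) (u : R) : bool :=
  u <= jump_prob (rule (past s)).1 (rule (past s)).2.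

Definition next (s : state) (u : R) (b : bool) : state :=
  State (rcons (past s) (rule (past s), u))
    (if jumps s u then
       if b then shift s - (shift s + 1) else shift s + (shift s + 1)
     else shift s).

(* The state after [i] steps, or the final one if the procedure stops
   earlier; step [i] is carried out iff [running (run u b i)]. *)
Fixpoint run (u : nat -> R) (b : nat -> bool) (i : nat) : state :=
  if i is k.+1 then
    let s := run u b k in if running s then next s (u k) (b k) else s
  else State [::] 0.

End Procedure.

(* One measurability condition per history length. *)
Definition measurable_rule (R : realType) (rule : history R -> nat * nat) :
    Prop :=
  forall i : nat,
    measurable_fun setT (fun h : i.-tuple (nat * nat * R)%type => rule h).

(* Suitability of the selected pair is only required at the steps that are
   carried out; [rule] is unconstrained on histories that do not occur. *)
Record pairing_coupling (R : realType) (theta : R) (n : nat)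
    d (T : measurableType d) (P : probability T R)
    (U : nat -> {RV P >-> R}) (J : nat -> {RV P >-> bool})
    (rule : history R -> nat * nat) : Prop := PairingCoupling {
  uniform_U : forall (i : nat) (A : set R), measurable A ->
    distribution P (U i) A = uniform_prob (@ltr01 R) A;
  bernoulli_J : forall (i : nat) (A : set bool), measurable A ->
    distribution P (J i) A = bernoulli_prob (2^-1 : R) A;
  independent_UJ : jointly_independent U J;
  measurable_selection : measurable_rule rule;
  suitable_selection : forall (w : T) (i : nat),
    let s := run theta n rule (U ^~ w) (J ^~ w) i in
    running n s -> suitable n s (rule (past s)).1 (rule (past s)).2 }.

Definition unsuccessful (R : realType) (theta : R) (n : nat)
    d (T : measurableType d) (P : probability T R)
    (U : nat -> {RV P >-> R}) (J : nat -> {RV P >-> bool})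
    (rule : history R -> nat * nat) : set T :=
  [set w | forall i : nat,
    let s := run theta n rule (U ^~ w) (J ^~ w) i in
    running n s -> ~~ (jumps theta rule s (U i w) && J i w)].

Definition lower_bound (R : realType) (theta : R) (n : nat) : R :=
  \prod_(1 <= i < (n %/ 2).+1)
    (1 - 2^-1 * Num.min (theta / i%:R) (expR 1)^-1).

(* Main.v *)
(** Before success, a step that selects the pair [m] fails to succeed with
    conditional probability [1 - p(m)/2], since the variates of the step are
    independent of the past. By backward induction over the steps, the coupling
    is unsuccessful with probability at least the least value of
    [prod (1 - p(m)/2)] over all lists of disjoint pairs [m] in [1, n].
    Each such product is bounded below by sorting the pairs by their larger
    index: the [k]-th larger index is at least [2k], which gives
    [p(m) <= min(theta/k, 1/e)].
    For the asymptotics, with [a = theta/2], the factors [1 - a/i] lie between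
    [((i - a - 1)/(i - a))^a] and [(i/(i + 1))^a], and both products telescope. *)

From mathcomp Require Import ring lra zify.
Require Import Defs.

Set Implicit Arguments.
Unset Strict Implicit.
Unset Printing Implicit Defensive.

Local Open Scope classical_set_scope.
Local Open Scope ring_scope.

(** * The deterministic bound *)

Section DeterministicBound.
Variables (R : realType) (theta : R).
Hypothesis theta_gt0 : 0 < theta.

Definition factor (i : nat) : R :=
  1 - 2^-1 * Num.min (theta / i%:R) (expR 1)^-1.

Definition no_success_prob (m : nat * nat) : R :=
  1 - 2^-1 * jump_prob theta m.1 m.2.

Lemma expR1V_lt1 : (expR 1 : R)^-1 < 1.
Proof. by rewrite invf_lt1 ?expR_gt0// expR_gt1. Qed.

Lemma factor_gt0 i : 0 < factor i.
Proof.
have := expR1V_lt1.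
have : Num.min (theta / i%:R) (expR 1)^-1 <= (expR 1)^-1 by rewrite ge_min lexx orbT.
rewrite /factor; lra.
Qed.

Lemma factor_le1 i : factor i <= 1.
Proof.
have min_ge0 : 0 <= Num.min (theta / i%:R) (expR 1)^-1.
  by rewrite le_min invr_ge0 expR_ge0 andbT divr_ge0 ?ler0n ?(ltW theta_gt0).
by rewrite /factor lerBlDr lerDl mulr_ge0.
Qed.

Lemma lower_bound_gt0 n : 0 < lower_bound theta n.
Proof. by apply: prodr_gt0 => i _; exact: factor_gt0. Qed.

(** The maximum of [x * expR (- x)] is at [x = 1]: the tangent bound [1 + (x - 1) <= expR (x - 1)]
    gives it. *)
Lemma mulr_expRN_le (x : R) : x * expR (- x) <= (expR 1)^-1.
Proof.
rewrite expRN ler_pdivrMr ?expR_gt0// -expRN -expRD.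
by apply: le_trans (expR_ge1Dx _); rewrite addrA addrN add0r.
Qed.

Lemma jump_prob_ge0 m1 m2 : 0 <= jump_prob theta m1 m2.
Proof. by rewrite /jump_prob !mulr_ge0 ?expR_ge0 ?invr_ge0 ?ler0n ?(ltW theta_gt0). Qed.

(** For the first bound, drop both exponentials and use [2 / m2 <= 1 / k]. For the second, [m1 < m2]
    allows replacing [theta / m1] by [theta / m2] in the exponent, which leaves [x * expR (- x)] at
    [x = 2 * theta / m2]. *)
Lemma jump_prob_le m1 m2 k : (0 < k)%N -> (0 < m1 < m2)%N -> (k.*2 <= m2)%N ->
  jump_prob theta m1 m2 <= Num.min (theta / k%:R) (expR 1)^-1.
Proof.
move=> k_gt0 /andP[m1_gt0 m12] km2.
have m2_gt0 : (0 < m2)%N by apply: leq_trans m12.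
have x1x2 : theta / m2%:R <= theta / m1%:R.
  by rewrite ler_pM2l// lef_pV2 ?posrE ?ltr0n// ler_nat ltnW.
have x2k : 2 * (theta / m2%:R) <= theta / k%:R.
  rewrite mulrCA ler_pM2l// ler_pdivrMr ?ltr0n// mulrC ler_pdivlMr ?ltr0n//.
  by rewrite -natrM ler_nat mul2n.
have x2_ge0 : 0 <= theta / m2%:R by rewrite divr_ge0 ?ler0n ?ltW.
have e1 x : 0 <= x -> expR (- x) <= 1 :> R.
    by move=> ?; rewrite -expR0 ler_expR oppr_le0.
rewrite le_min; apply/andP; split.
  apply: le_trans x2k; rewrite /jump_prob.
  rewrite -mulrA -mulrA ler_pM2l// mulrCA ler_piMr// -expRD -opprD e1// addr_ge0//.
  by rewrite (le_trans x2_ge0).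
apply: le_trans (mulr_expRN_le (2 * (theta / m2%:R))).
have -> : - (2 * (theta / m2%:R)) = - (theta / m2%:R) - theta / m2%:R by ring.
rewrite expRD mulrA /jump_prob ler_pM2r ?expR_gt0// mulrAC.
by apply: ler_wpM2l; [exact: mulr_ge0|rewrite ler_expR lerN2].
Qed.

Lemma factor_le_no_success_prob m k :
  (0 < k)%N -> (0 < m.1 < m.2)%N -> (k.*2 <= m.2)%N ->
  factor k <= no_success_prob m.
Proof.
by move=> *; rewrite lerD2l lerN2 ler_pM2l ?invr_gt0// jump_prob_le.
Qed.

Definition indices (ms : seq (nat * nat)) : seq nat :=
  flatten [seq [:: m.1; m.2] | m <- ms].

Definition valid_pairs (n : nat) (ms : seq (nat * nat)) : bool :=
  all (fun m => (0 < m.1 < m.2) && (m.2 <= n))%N ms && uniq (indices ms).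

Lemma size_indices ms : size (indices ms) = (size ms).*2.
Proof. by elim: ms => //= m ms ->; rewrite doubleS. Qed.

Lemma mem_indicesP ms i : i \in indices ms ->
  exists2 m, m \in ms & (i == m.1) || (i == m.2).
Proof.
by move=> /flatten_mapP[m mms]; rewrite !inE => im; exists m.
Qed.

Lemma size_valid_pairs n ms : valid_pairs n ms -> ((size ms).*2 <= n)%N.
Proof.
move=> /andP[/allP good uniq_ms]; rewrite -size_indices -[n](size_iota 1).
apply: uniq_leq_size => // i /mem_indicesP[m /good].
move=> /andP[/andP[m1_gt0 m12] m2n]; rewrite mem_iota add1n ltnS.
move=> /orP[] /eqP ->; first by rewrite m1_gt0 (leq_trans (ltnW m12)).
by rewrite m2n (leq_trans m1_gt0 (ltnW m12)).
Qed.

Lemma perm_valid_pairs n ms ms' : perm_eq ms ms' ->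
  valid_pairs n ms = valid_pairs n ms'.
Proof.
move=> ms_ms'; rewrite /valid_pairs (perm_all _ ms_ms'); congr (_ && _).
by apply/perm_uniq/perm_flatten/perm_map.
Qed.

(** The head has the largest index of all, so the whole list is already valid on [[1, m.2]].
    Counting distinct indices there shows that [m.2] is at least twice the length, so the head can
    be matched with the last factor. *)
Lemma prod_factor_le_sorted n ms : sorted (fun m m' => m'.2 <= m.2)%N ms ->
  valid_pairs n ms ->
  \prod_(1 <= i < (size ms).+1) factor i <= \prod_(m <- ms) no_success_prob m.
Proof.
elim: ms n => [|m ms IH] n; first by rewrite big_nil big_nil.
rewrite /= path_sortedE; last by move=> ? ? ? ? h; exact: leq_trans h _.
move=> /andP[/allP ms_le sorted_ms] valid_mms.
have valid_ms : valid_pairs n ms.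
  by move: valid_mms => /andP[/= /andP[_ A] /and3P[_ _ B]]; apply/andP.
have mP : (0 < m.1 < m.2)%N by move: valid_mms => /andP[/= /andP[/andP[]]].
have := @size_valid_pairs m.2 (m :: ms); rewrite /valid_pairs.
move: valid_mms => /andP[/= /andP[_ /allP good] ->]; rewrite andbT => m_big.
rewrite big_nat_recr//= big_cons mulrC ler_pM ?(ltW (factor_gt0 _))//.
- by apply: prodr_ge0 => i _; exact/ltW/factor_gt0.
- apply: factor_le_no_success_prob => //; apply: m_big; rewrite mP leqnn/=.
  apply/allP => m' m'ms; rewrite ms_le// andbT.
  by move: (good _ m'ms) => /andP[].
- exact: IH sorted_ms valid_ms.
Qed.

(* In increasing order of the larger index, the [k]-th pair has a larger index
   that is at least [2 k], since [2 k] distinct indices do not exceed it. *)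
Lemma lower_bound_le_prod n ms : valid_pairs n ms ->
  lower_bound theta n <= \prod_(m <- ms) no_success_prob m.
Proof.
move=> valid_ms; pose leT (m m' : nat * nat) := (m'.2 <= m.2)%N.
have /permPl perm_ms := perm_sort leT ms.
rewrite -(perm_big _ perm_ms)/=.
apply: le_trans (prod_factor_le_sorted (n := n) _ _); last first.
- by rewrite (perm_valid_pairs _ perm_ms).
- by apply: sort_sorted => m m'; exact: leq_total.
have sz : ((size ms) <= n %/ 2)%N.
  by rewrite leq_divRL// muln2 size_valid_pairs.
(* The factors beyond [size ms] lie in [[0, 1]], so including them only lowers the product. *)
rewrite size_sort /lower_bound (big_cat_nat (n := (size ms).+1))//=.
rewrite -[leRHS]mulr1 ler_wpM2l//.
  by apply: prodr_ge0 => i _; exact/ltW/factor_gt0.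
by apply: prodr_ile1 => i; rewrite factor_le1 ltW ?factor_gt0.
Qed.

Lemma no_success_prob_gt0 m : (0 < m.1 < m.2)%N -> 0 < no_success_prob m.
Proof.
move=> mP; apply: lt_le_trans (factor_gt0 1) _.
by apply: factor_le_no_success_prob => //; case/andP: mP; lia.
Qed.

Lemma jump_prob_le1 m : (0 < m.1 < m.2)%N -> jump_prob theta m.1 m.2 <= 1.
Proof.
move=> mP; apply: (le_trans (jump_prob_le (k := 1) _ _ _)) => //.
  by case/andP: mP; lia.
by rewrite ge_min (ltW expR1V_lt1) orbT.
Qed.

End DeterministicBound.

(** * Asymptotics *)

Section Asymptotics.
Variable R : realType.

Lemma powR_expR (x r : R) : 0 < x -> x `^ r = expR (r * ln x).
Proof. by move=> x_gt0; rewrite /powR gt_eqF. Qed.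

Lemma ler_powRN (a x y : R) : 0 <= a -> 0 < x -> x <= y -> y `^ (- a) <= x `^ (- a).
Proof.
move=> a_ge0 x_gt0 xy; have y_gt0 := lt_le_trans x_gt0 xy.
by rewrite !powR_expR// ler_expR !mulNr lerN2 ler_wpM2l// ler_ln.
Qed.

(** Combine [1 - a / x <= expR (- (a / x))] with [ln (x + 1) <= ln x + 1 / x]. *)
Lemma powRN_step_ge (a x : R) : 0 <= a -> 0 < x ->
  (1 - a / x) * x `^ (- a) <= (x + 1) `^ (- a).
Proof.
move=> a_ge0 x_gt0.
have x1_gt0 : 0 < x + 1 by rewrite addr_gt0.
have ln_le : ln (x + 1) <= ln x + x^-1.
  have -> : x + 1 = x * (1 + x^-1) by rewrite mulrDr mulr1 divff ?gt_eqF.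
  rewrite lnM ?posrE ?addr_gt0 ?invr_gt0// lerD2l le_ln1Dx//.
  by rewrite (lt_trans (ltrN10 _)) ?invr_gt0.
rewrite !powR_expR// (le_trans (ler_wpM2r (expR_ge0 _) (expR_ge1Dx _)))//.
rewrite -expRD ler_expR !mulNr -opprD lerN2 -mulrDr [_^-1 + _]addrC.
exact: ler_wpM2l.
Qed.

(** The shift to [y = x - a] makes [1 - a / x] equal to [(1 + a / y)^-1], hence at least
    [expR (- (a / y))]; then use [ln (y - 1) <= ln y - 1 / y]. *)
Lemma powRN_step_le (a x : R) : 0 <= a -> a + 1 < x ->
  (x - a) `^ (- a) <= (1 - a / x) * (x - a - 1) `^ (- a).
Proof.
move=> a_ge0 ax; set y := x - a.
have y1_gt0 : 0 < y - 1 by rewrite /y; lra.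
have y_gt0 : 0 < y by lra.
have x_gt0 : 0 < x by lra.
have ln_le : ln (y - 1) <= ln y - y^-1.
  have -> : y - 1 = y * (1 - y^-1) by rewrite mulrDr mulr1 mulrN divff ?gt_eqF.
  have yV_lt1 : y^-1 < 1 by rewrite invf_lt1//; lra.
  by rewrite lnM ?posrE// ?subr_gt0// lerD2l le_ln1Dx// ltrN2.
have factor_ge : expR (- (a / y)) <= 1 - a / x.
  have -> : 1 - a / x = (1 + a / y)^-1.
    rewrite /y; field; rewrite !gt_eqF// ?subrK//.
  rewrite expRN lef_pV2 ?posrE ?expR_gt0 ?expR_ge1Dx//.
  by rewrite ltr_wpDr// divr_ge0// ltW.
rewrite !powR_expR//.
apply: le_trans (ler_wpM2r (expR_ge0 _) factor_ge).
rewrite -expRD ler_expR !mulNr -opprD lerN2.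
have := ler_wpM2l a_ge0 ln_le; rewrite mulrBr; lra.
Qed.

Lemma asymp_lower_bound (theta : R) : 0 < theta ->
  asymp (lower_bound theta) (fun n => n%:R `^ (- theta / 2)).
Proof.
move=> theta_gt0; pose a := theta / 2.
have a_gt0 : 0 < a by rewrite /a divr_gt0.
have -> : - theta / 2 = - a by rewrite mulNr.
pose L N := \prod_(1 <= i < N.+1) factor theta i.
have L_gt0 N : 0 < L N by apply: prodr_gt0 => i _; exact: factor_gt0.
have LS N : L N.+1 = L N * factor theta N.+1 by rewrite /L big_nat_recr.
(* From [i0] on, [theta * expR 1 < i] makes [theta / i] the minimum, and [a + 2 < i] keeps all the
   bases of powers positive. *)
pose i0 := (Num.bound (theta * expR 1 + a + 2)).
have i0_gt : theta * expR 1 + a + 2 < i0%:R.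
  apply: archi_boundP; rewrite !addr_ge0 ?(ltW a_gt0)// mulr_ge0 ?expR_ge0//.
  exact: ltW.
have te_ge0 : 0 <= theta * expR 1 by rewrite mulr_ge0 ?expR_ge0// ltW.
have large i : (i0 <= i)%N -> theta * expR 1 + a + 2 < i%:R.
  by move=> ?; apply: lt_le_trans i0_gt _; rewrite ler_nat.
have factorE i : (i0 <= i)%N -> factor theta i = 1 - a / i%:R.
  move=> /large i_gt; rewrite /factor min_l.
    by rewrite /a mulrCA mulrA mulrAC.
  have i_gt0 : 0 < i%:R :> R by lra.
  by rewrite ler_pdivrMr// mulrC ler_pdivlMr ?expR_gt0//; lra.
(* [C], like [c] below, is normalised so that its bound is an equality at [N = i0]. *)
pose C := L i0 / (i0%:R + 1) `^ (- a).
have upper N : (i0 <= N)%N -> L N <= C * (N%:R + 1) `^ (- a).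
  move=> /subnK <-; elim: (N - i0)%N => [|k IH].
    by rewrite add0n /C mulfVK// gt_eqF// powR_gt0 ?addr_gt0 ?ltr0n.
  rewrite addSn LS factorE ?leqW ?leq_addl//.
  apply: le_trans (ler_wpM2r _ IH) _.
    by rewrite -factorE ?leqW ?leq_addl// ltW ?factor_gt0.
  rewrite -mulrA (natr1 (k + i0)).
  rewrite ler_wpM2l ?divr_ge0 ?powR_ge0 ?(ltW (L_gt0 _))// mulrC.
  by apply: powRN_step_ge; rewrite ?ltr0n// ltW.
pose c := L i0 / (i0%:R - a) `^ (- a).
have i0a_gt0 : 0 < i0%:R - a by lra.
have c_gt0 : 0 < c by rewrite divr_gt0 ?powR_gt0.
have lower N : (i0 <= N)%N -> c * (N%:R - a) `^ (- a) <= L N.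
  move=> /subnK <-; elim: (N - i0)%N => [|k IH].
    by rewrite add0n /c mulfVK// gt_eqF// powR_gt0.
  have := large (k + i0).+1 (leqW (leq_addl _ _)); rewrite addSn => ki_gt.
  rewrite LS factorE ?leqW ?leq_addl// [leRHS]mulrC.
  apply: le_trans (ler_wpM2l _ IH).
    rewrite mulrCA ler_wpM2l// ?(ltW c_gt0)//.
    apply: le_trans (powRN_step_le _ _) _; [exact: ltW|lra|].
    by rewrite -natr1 addrAC addrK.
  by rewrite -factorE ?leqW ?leq_addl// ltW ?factor_gt0.
(* The factor [2 ^ a] pays for replacing [n %/ 2 + 1] by [n / 2]; the maximum secures [c <= C]. *)
exists c, (Num.max c (C * 2 `^ a)); split => //; first by rewrite le_max lexx.
near=> n.
have n_big : (i0.*2 <= n)%N by near: n; exact: nbhs_infty_ge.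
have half_ge : (i0 <= n %/ 2)%N by rewrite leq_divRL// muln2.
have half_gt := large _ half_ge.
have half_le : (n %/ 2)%:R <= n%:R :> R by rewrite ler_nat leq_div.
have half1_ge : n%:R / 2 <= (n %/ 2)%:R + 1 :> R.
  by rewrite ler_pdivrMr// natr1 -natrM ler_nat ltnW// ltn_ceil.
apply/andP; split.
  apply: le_trans (lower _ half_ge); rewrite ler_pM2l//.
  by apply: ler_powRN; lra.
apply: le_trans (upper _ half_ge) _.
apply: (@le_trans _ _ (C * (n%:R / 2) `^ (- a))).
  rewrite ler_wpM2l ?divr_ge0 ?powR_ge0 ?(ltW (L_gt0 _))//.
  by apply: ler_powRN; lra.
rewrite powRM// -[2^-1]powR_inv1// -powRrM mulN1r opprK mulrCA mulrC.
by rewrite [C * _]mulrC mulrC [leRHS]mulrC ler_wpM2l ?powR_ge0// le_max mulrC lexx orbT.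
Unshelve. all: by end_near.
Qed.

End Asymptotics.

(** * Independence of generated sigma-algebras *)

(** When the classes are closed under intersection, this is a pi-system; it generates the joint
    sigma-algebra of the classes indexed by [D]. *)
Definition cylinders (T : Type) (I : choiceType) (E : I -> set (set T))
    (D : {fset I}) : set (set T) :=
  [set B | exists2 A : I -> set T, (forall i, i \in D -> E i (A i)) &
    B = \bigcap_(i in [set` D]) A i].

Section Independence.
Context d (T : measurableType d) (R : realType) (P : probability T R).
Variables (I : choiceType) (E : I -> set (set T)).
Hypothesis indep : mutually_independent P E.
Hypothesis setIE : forall i, setI_closed (E i).
Hypothesis setTE : forall i, E i setT.
Hypothesis measurableE : forall i, E i `<=` measurable.
Implicit Types (D : {fset I}) (A B C : set T).

Lemma setI_closed_cylinders D : setI_closed (cylinders E D).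
Proof.
move=> _ _ [A EA ->] [A' EA' ->]; exists (fun i => A i `&` A' i).
  by move=> i iD; apply: setIE; [exact: EA|exact: EA'].
by rewrite bigcapI.
Qed.

Lemma cylinders_measurable D : cylinders E D `<=` measurable.
Proof.
move=> _ [A EA ->]; apply: fin_bigcap_measurable => // i iD.
exact/measurableE/EA.
Qed.

Lemma cylindersT D : cylinders E D setT.
Proof. by exists (fun=> setT) => //; rewrite bigcapT. Qed.

Lemma cylinders1 i A : E i A -> cylinders E [fset i]%fset A.
Proof.
move=> EA; exists (fun=> A); first by move=> j /fset1P ->.
apply/seteqP; split=> [x Ax j _//|x]; apply; exact: fset11.
Qed.

Lemma cylinders_sub D D' : (D `<=` D')%fset -> cylinders E D `<=` cylinders E D'.
Proof.
move=> /fsubsetP DD' _ [A EA ->]; exists (fun i => if i \in D then A i else setT).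
  by move=> i _; case: ifPn => // /EA.
apply/seteqP; split=> [x Ax i /= _|x Ax i /= iD].
  by case: ifPn => // /Ax.
by have := Ax i (DD' _ iD); rewrite iD.
Qed.

(** Disjointness lets the two families be glued into one over the union, whose product formula then
    splits along [D] and [D']. *)
Lemma cylinders_cylinders D D' B C : [disjoint D & D']%fset ->
  cylinders E D B -> cylinders E D' C ->
  cylinders E (D `|` D')%fset (B `&` C) /\ P (B `&` C) = (P B * P C)%E.
Proof.
move=> DD' [A EA BE] [A' EA' CE].
pose A'' i := if i \in D then A i else A' i.
have nD i : i \in D' -> (i \in D) = false.
  by move=> iD'; apply: contraTF DD' => iD; apply/fdisjointP => /(_ _ iD)/negP.
have EA'' i : i \in (D `|` D')%fset -> E i (A'' i).
  by rewrite inE /A''; case: ifPn => [/EA//|_ /= /EA'].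
have BCE : B `&` C = \bigcap_(i in [set` (D `|` D')%fset]) A'' i.
  rewrite BE CE; apply/seteqP; split=> [x [Ax A'x] i /=|x A''x].
    by rewrite inE /A''; case: ifPn => [/Ax//|_ /= /A'x].
  split=> i /= iD.
    by have := A''x i; rewrite /= inE /A'' iD; exact.
  by have := A''x i; rewrite /= inE /A'' iD nD//; exact.
split; first by exists A''.
rewrite BCE indep// (big_fsetID _ (mem D)) BE CE !indep//; congr (_ * _)%E.
- have -> : [fset x in D `|` D' | mem D x]%fset = D.
    by apply/fsetP => i; rewrite !inE/=; case: (i \in D); rewrite ?andbF.
  by rewrite big_seq [RHS]big_seq; apply: eq_bigr => i iD; rewrite /A'' iD.
- have -> : [fset x in D `|` D' | ~~ mem D x]%fset = D'.
    apply/fsetP => i; rewrite !inE/=; have := nD i.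
    by case: (i \in D); case: (i \in D') => // /(_ isT).
  by rewrite big_seq [RHS]big_seq; apply: eq_bigr => i iD; rewrite /A'' nD.
Qed.

Lemma sigma_cylinders_measurable D : <<s cylinders E D >> `<=` measurable.
Proof.
apply: smallest_sub; [exact: sigma_algebra_measurable|].
exact: cylinders_measurable.
Qed.

(** The finite measures [P (_]&[C)] and [P C * P _] agree on the pi-system of cylinders over [D],
    hence on the sigma-algebra it generates. *)
Lemma sigma_cylinders_independent D D' B C : [disjoint D & D']%fset ->
  <<s cylinders E D >> B -> cylinders E D' C -> P (B `&` C) = (P B * P C)%E.
Proof.
move=> DD' sB cC; have mC := cylinders_measurable cC.
pose c := NngNum (fine_ge0 (measure_ge0 P C)).
have PCE : P C = c%:num%:E by rewrite /= fineK// fin_num_measure.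
pose m1 : {measure set T -> \bar R} := mrestr P mC.
pose m2 : {measure set T -> \bar R} := mscale c P.
suff : m1 B = m2 B by rewrite /= /mscale -PCE muleC.
apply: (g_sigma_algebra_measure_unique _ (@cylinders_measurable D)
  (fun=> setT)) => //.
- by move=> _; exact: cylindersT.
- by rewrite bigcup_const//; exists 0%N.
- exact: setI_closed_cylinders.
- move=> A cA; rewrite /= /mscale /mrestr -PCE muleC.
  by have [] := cylinders_cylinders DD' cA cC.
- by move=> _; rewrite /= /mrestr setTI ltey_eq fin_num_measure.
Qed.

End Independence.

(** * Events determined by the variates of the first steps *)

Section Past.
Context d (T : measurableType d) (R : realType) (P : probability T R).
Variables (U : nat -> {RV P >-> R}) (J : nat -> {RV P >-> bool}).

Definition variate_events (i : nat + nat) : set (set T) :=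
  match i with
  | inl i => g_sigma_algebra_preimage (U i)
  | inr i => g_sigma_algebra_preimage (J i)
  end.

Lemma variate_eventsI i : setI_closed (variate_events i).
Proof.
by case: i => i _ _ [A mA <-] [B mB <-]; exists (A `&` B);
  rewrite ?setTI//; exact: measurableI.
Qed.

Lemma variate_eventsT i : variate_events i setT.
Proof. by case: i => i; exists setT; rewrite ?setTI. Qed.

Lemma variate_events_measurable i : variate_events i `<=` measurable.
Proof. by case: i => i _ [A mA <-]; exact: measurable_funP. Qed.

Fixpoint past_indices (k : nat) : {fset nat + nat} :=
  if k is k'.+1 then (past_indices k' `|` [fset inl k'; inr k'])%fset else fset0.

Lemma mem_past_indices k i :
  (i \in past_indices k) = (match i with inl j | inr j => j end < k)%N.
Proof.
elim: k => [|k IH]; first by case: i.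
rewrite /= in_fsetU IH !inE.
by case: i {IH} => j; rewrite ltnS [in RHS]leq_eqVlt [RHS]orbC; congr (_ || _);
  rewrite ?orbF.
Qed.

(* The sigma-algebra generated by [U_i, J_i] for [i < k]. *)
Definition past_events (k : nat) : set (set T) :=
  <<s cylinders variate_events (past_indices k) >>.

Let pastType k := g_sigma_algebraType (cylinders variate_events (past_indices k)).

Lemma past_events_measurable k : past_events k `<=` measurable.
Proof. exact/sigma_cylinders_measurable/variate_events_measurable. Qed.

Lemma past_eventsT k : past_events k setT.
Proof. exact: (@measurableT _ (pastType k)). Qed.

Lemma past_eventsI k A B :
  past_events k A -> past_events k B -> past_events k (A `&` B).
Proof. exact: (@measurableI _ (pastType k)). Qed.

Lemma past_eventsC k A : past_events k A -> past_events k (~` A).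
Proof. exact: (@measurableC _ (pastType k)). Qed.

Lemma past_events_sub k l : (k <= l)%N -> past_events k `<=` past_events l.
Proof.
move=> kl; apply: sub_sigma_algebra2; apply: cylinders_sub.
  exact: variate_eventsT.
by apply/fsubsetP => -[j|j]; rewrite !mem_past_indices => /leq_trans; exact.
Qed.

Lemma past_events_variate k i A : i \in past_indices k ->
  variate_events i A -> past_events k A.
Proof.
move=> ik iA; apply: sub_sigma_algebra; move: (cylinders1 iA).
by apply: cylinders_sub; [exact: variate_eventsT|rewrite fsub1set].
Qed.

Lemma past_events_U k i (A : set R) : (i < k)%N -> measurable A ->
  past_events k (U i @^-1` A).
Proof.
move=> ik mA; apply: (@past_events_variate _ (inl i)).
  by rewrite mem_past_indices.
by exists A => //; rewrite setTI.
Qed.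

Lemma past_events_J k i (A : set bool) : (i < k)%N ->
  past_events k (J i @^-1` A).
Proof.
move=> ik; apply: (@past_events_variate _ (inr i)).
  by rewrite mem_past_indices.
by exists A => //; rewrite setTI.
Qed.

Section Independent.
Hypothesis indep : jointly_independent U J.

(** The event of step [k] is a cylinder over [inl k] and [inr k], which lie outside
    [past_indices k]. *)
Lemma past_events_independent k B (A : set R) (A' : set bool) :
  past_events k B -> measurable A ->
  P (B `&` (U k @^-1` A `&` J k @^-1` A')) =
  (P B * (P (U k @^-1` A) * P (J k @^-1` A')))%E.
Proof.
move=> pB mA.
have cU : cylinders variate_events [fset inl k]%fset (U k @^-1` A).
  by apply: cylinders1; exists A; rewrite ?setTI.
have cJ : cylinders variate_events [fset inr k]%fset (J k @^-1` A').
  by apply: cylinders1; exists A'; rewrite ?setTI.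
have UJ : [disjoint [fset inl k] & [fset inr k]]%fset.
  by apply/fdisjointP => i /fset1P ->; rewrite inE.
have [cUJ PUJ] := cylinders_cylinders indep UJ cU cJ.
rewrite -PUJ; apply: (sigma_cylinders_independent indep _ _ _ _ pB cUJ).
- exact: variate_eventsI.
- exact: variate_eventsT.
- exact: variate_events_measurable.
- apply/fdisjointP => i; rewrite mem_past_indices !inE.
  by apply: contraTN => /orP[] /eqP ->; rewrite ltnn.
Qed.

End Independent.

(** Once the past pairs are fixed, the history is a measurable function of [U_0, ..., U_(k-1)]
    alone, and [rule] is measurable on histories of length [k]. *)
Lemma past_events_selection k (rule : history R -> nat * nat)
    (pairs : nat -> nat * nat) (m : nat * nat) : measurable_rule rule ->
  past_events k [set w | rule (mkseq (fun i => (pairs i, U i w)) k) = m].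
Proof.
move=> mrule.
pose h (w : pastType k) : k.-tuple (nat * nat * R) :=
  [tuple (pairs i, U i w) | i < k].
have hE w : h w = mkseq (fun i => (pairs i, U i w)) k :> seq _.
  by rewrite /mkseq -val_enum_ord -map_comp.
have mh : measurable_fun setT h.
  apply/measurable_fun_tnthP => i.
  rewrite [X in measurable_fun _ X](_ : _ = fun w => (pairs i, U i w)); last first.
    by apply/funext => w; rewrite /= tnth_mktuple.
  apply: measurable_fun_pair; first exact: measurable_cst.
  by move=> _ A mA; rewrite setTI; exact: past_events_U.
have m1 : measurable [set m].
  rewrite [X in measurable X](_ : _ = [set m.1] `*` [set m.2]).
    exact: measurableX.
  by case: m => m1 m2; apply/seteqP; split=> [_ ->//|[? ?] [/= -> ->]].
have := measurableT_comp (mrule k) mh.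
move=> /(_ measurableT _ m1); rewrite setTI.
by congr (past_events k _); apply/seteqP; split=> w /=; rewrite hE.
Qed.

End Past.

(** * Backward induction over the steps *)

Lemma uniform_prob01_itvNyc (R : realType) (p : R) : 0 <= p <= 1 ->
  uniform_prob (@ltr01 R) `]-oo, p] = p%:E.
Proof.
move=> /andP[p_ge0 p_le1]; rewrite /uniform_prob integral_uniform_pdf.
have -> : `]-oo, p] `&` `[0, 1] = `[0, p]%classic :> set R.
  apply/seteqP; split=> x /=; rewrite !in_itv/=.
    by move=> [-> /andP[->]].
  by move=> /andP[-> xp]; rewrite xp (le_trans xp).
rewrite (eq_integral (fun=> 1%E)); last first.
  move=> x; rewrite inE/= in_itv/= => /andP[x_ge0 xp].
  by rewrite /uniform_pdf x_ge0 (le_trans xp p_le1) subr0 invr1.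
rewrite integral_cst//= mul1e lebesgue_measure_itv/= lte_fin.
by case: ltgtP p_ge0 => // [_ _|<- _]; rewrite ?oppr0 ?adde0.
Qed.

Section Coupling.
Context (R : realType) (theta : R) (n : nat) d (T : measurableType d)
  (P : probability T R) (U : nat -> {RV P >-> R}) (J : nat -> {RV P >-> bool})
  (rule : history R -> nat * nat).
Hypothesis theta_gt0 : 0 < theta.
Hypothesis coupling : pairing_coupling theta n U J rule.

Let st w i := run theta n rule (U ^~ w) (J ^~ w) i.
Let F := unsuccessful theta n U J rule.

(** This says that [F] has conditional probability at least [c] given [A], in a form that allows
    null [A]. Measurability of [F] is not presupposed but established along with the bound. *)
Definition bounded_below (c : R) (A : set T) :=
  measurable (A `&` F) /\ (P A * c%:E <= P (A `&` F))%E.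

Lemma bounded_below0 c : bounded_below c set0.
Proof. by split; rewrite set0I// measure0 mul0e. Qed.

Lemma bounded_belowU c A B : measurable A -> measurable B -> A `&` B = set0 ->
  bounded_below c A -> bounded_below c B -> bounded_below c (A `|` B).
Proof.
move=> mA mB AB0 [mAF PA] [mBF PB]; split; rewrite setIUl.
  exact: measurableU.
rewrite !measureU//; last by rewrite setIACA AB0 set0I.
by rewrite ge0_muleDl ?measure_ge0// leeD.
Qed.

Definition variates_history (ms : seq (nat * nat)) (w : T) : history R :=
  mkseq (fun i => (nth (0, 0)%N ms i, U i w)) (size ms).

Lemma used_variates_history ms w : used (variates_history ms w) = indices ms.
Proof.
rewrite /used /indices; congr flatten.
rewrite -[ms in RHS](mkseq_nth (0, 0)%N) /variates_history /mkseq -!map_comp.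
exact: eq_map.
Qed.

Lemma variates_history_rcons ms m w :
  variates_history (rcons ms m) w =
  rcons (variates_history ms w) (m, U (size ms) w).
Proof.
rewrite /variates_history size_rcons mkseqS nth_rcons ltnn eqxx; congr rcons.
apply/eq_in_map => i; rewrite mem_iota add0n => /andP[_ i_lt].
by rewrite nth_rcons i_lt.
Qed.

(** Suitability sees the past only through the used indices, which the values of the [U_i] do not
    affect. *)
Lemma running_variates_history ms w w' v :
  running n (State (variates_history ms w) v) =
  running n (State (variates_history ms w') v).
Proof.
rewrite /running /=; congr (_ && _).
apply: eq_existsb => m1; apply: eq_existsb => m2.
by rewrite /suitable /= !used_variates_history.
Qed.

Lemma run_stopped w i k : ~~ running n (st w i) -> (i <= k)%N -> st w k = st w i.
Proof.
move=> stop /subnK <-; elim: (k - i)%N => //= j IH.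
by rewrite addSn /st /= -/(st _ _) IH (negbTE stop).
Qed.

(** The removed event concerns step [k] only, so it is independent of [B] and has probability
    [p / 2]. *)
Lemma no_success_step k B p : past_events U J k B -> 0 <= p <= 1 ->
  (P B * (1 - 2^-1 * p)%:E <=
   P (B `\` (U k @^-1` `]-oo, p] `&` J k @^-1` [set true])))%E.
Proof.
move=> pB p01; have mB := past_events_measurable pB.
set S := _ `&` _.
have mS : measurable S by apply: measurableI; exact: measurable_funPTI.
have PBS : P (B `&` S) = (P B * (p%:E * (2^-1)%:E))%E.
  rewrite (past_events_independent (independent_UJ coupling) _ pB)//.
  congr (_ * (_ * _))%E.
    by rewrite -(uniform_prob01_itvNyc p01); exact: (uniform_U coupling).
  transitivity (bernoulli_prob (2^-1 : R) [set true]).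
    exact: (bernoulli_J coupling).
  rewrite bernoulli_probE ?invr_ge0 ?ler0n ?invf_le1 ?ler1n//.
  by rewrite !diracE mem_set// memNset//= mule1 mule0 adde0.
have -> : P (B `\` S) = (P B - P (B `&` S))%E.
  by apply: measureD => //; rewrite ltey_eq fin_num_measure.
rewrite PBS.
rewrite -(fineK (fin_num_measure P _ mB)) -!EFinM -EFinB lee_fin.
by rewrite [p * _]mulrC mulrBr mulr1.
Qed.

Lemma valid_pairs_rcons ms v w m :
  valid_pairs n ms -> suitable n (State (variates_history ms w) v) m.1 m.2 ->
  valid_pairs n (rcons ms m).
Proof.
move=> valid_ms /and5P[m1_gt0 m12 m2n /=]; rewrite !used_variates_history.
move=> m1_new /andP[m2_new _].
rewrite (@perm_valid_pairs _ _ (m :: ms)); last by rewrite perm_rcons.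
move: valid_ms => /andP[all_ms uniq_ms].
rewrite /valid_pairs /= m1_gt0 m12 m2n all_ms -/(indices ms) uniq_ms m2_new.
by rewrite inE negb_or m1_new andbT (ltn_eqF m12).
Qed.

(* Fixing [ms] and [v] on [B] fixes everything that the next steps use from
   the past, except for the values of the [U_i], which only affect [rule]. *)
Definition unsuccessful_path (ms : seq (nat * nat)) (v : int) (B : set T) :=
  [/\ past_events U J (size ms) B,
      forall w, B w -> st w (size ms) = State (variates_history ms w) v
    & forall w i, B w -> (i < size ms)%N -> running n (st w i) ->
        ~~ (jumps theta rule (st w i) (U i w) && J i w)].

(** On [C] both the selected pair and the occurrence [j] of a jump are constant; as success is
    excluded there, a jump must be upward, which determines the new shift. *)
Lemma unsuccessful_path_step ms v (B C : set T) m j :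
  unsuccessful_path ms v B -> C `<=` B -> past_events U J (size ms).+1 C ->
  (forall w, C w -> running n (st w (size ms))) ->
  (forall w, C w -> rule (variates_history ms w) = m) ->
  (forall w, C w -> (U (size ms) w <= jump_prob theta m.1 m.2) = j) ->
  (forall w, C w -> ~~ (j && J (size ms) w)) ->
  unsuccessful_path (rcons ms m) (if j then v + (v + 1) else v) C.
Proof.
move=> [pB stB noB] CB pC runC ruleC jC noC.
split; first by rewrite size_rcons.
  move=> w Cw; rewrite size_rcons /st /= -/(st _ _) runC// (stB w (CB w Cw)).
  rewrite variates_history_rcons /next /jumps /= ruleC// jC//.
  by have := noC w Cw; case: (j) => //= /negbTE ->.
move=> w i Cw; rewrite size_rcons ltnS leq_eqVlt => /orP[/eqP ->|i_lt] run_i.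
  by rewrite (stB w (CB w Cw)) /jumps /= ruleC// jC// noC.
exact: noB (CB _ Cw) i_lt run_i.
Qed.

(** Induction on [k], a bound on the steps still possible: [size ms + k] pairs would need more than
    [n] indices. The constant is the final bound with the factors of the steps already made divided
    out. *)
Lemma unsuccessful_path_bound k ms v B : (n < (size ms + k).*2)%N ->
  valid_pairs n ms -> unsuccessful_path ms v B ->
  bounded_below (lower_bound theta n / \prod_(m <- ms) no_success_prob theta m) B.
Proof.
elim: k ms v B => [|k IH] ms v B size_k valid_ms pathB.
  by move: size_k; rewrite addn0 ltnNge size_valid_pairs.
have [pB stB noB] := pathB.
have mB := past_events_measurable pB.
set c := _ / _.
have prod_gt0 (ms' : seq (nat * nat)) : valid_pairs n ms' ->
    0 < \prod_(m <- ms') no_success_prob theta m.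
  move=> /andP[/allP good _]; rewrite big_seq; apply: prodr_gt0 => m /good.
  by move=> /andP[mP _]; exact: no_success_prob_gt0.
(* Whether the procedure runs is the same at all points of [B]. If it has stopped, [B] lies inside
   [F], and the constant is at most 1 by the deterministic bound. *)
have [run_B|stop_B] := pselect (forall w, B w -> running n (st w (size ms)));
  last first.
  have stopB w : B w -> ~~ running n (st w (size ms)).
    move=> Bw; apply/negP => run_w; apply: stop_B => w' Bw'.
    rewrite stB// (running_variates_history ms w' w).
    by rewrite -stB.
  have BF : B `&` F = B.
    apply/setIidPl => w Bw i /=; rewrite -/(st w i) => run_i.
    have [i_lt|i_ge] := ltnP i (size ms); first exact: noB.
    by move: run_i; rewrite (run_stopped (stopB w Bw) i_ge) (negbTE (stopB w Bw)).
  rewrite /bounded_below BF; split => //.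
  rewrite -[leRHS]mule1 lee_wpmul2l ?measure_ge0// lee_fin /c.
  by rewrite ler_pdivrMr ?prod_gt0// mul1r lower_bound_le_prod.
have st_rule w : B w ->
    suitable n (State (variates_history ms w) v)
      (rule (variates_history ms w)).1 (rule (variates_history ms w)).2.
  move=> Bw; have := suitable_selection coupling (run_B w Bw).
  by rewrite -/(st w (size ms)) stB.
pose S m := [set w | rule (variates_history ms w) = m].
have pS m : past_events U J (size ms) (S m).
  by apply: past_events_selection; exact: measurable_selection coupling.
have bound_S m : bounded_below c (B `&` S m).
  (* A nonempty part contains an actual path, which certifies that [m] is suitable and so extends
     [ms] validly. *)
  have [->|/set0P[w0 [Bw0 Sw0]]] := eqVneq (B `&` S m) set0.
    exact: bounded_below0.
  have valid_m : valid_pairs n (rcons ms m).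
    apply: (valid_pairs_rcons (v := v) (w := w0)) => //.
    by have := st_rule _ Bw0; rewrite Sw0.
  have mP : (0 < m.1 < m.2)%N.
    move: valid_m => /andP[/allP/(_ m)].
    by rewrite mem_rcons mem_head => /(_ isT)/andP[].
  pose p := jump_prob theta m.1 m.2.
  pose Up := U (size ms) @^-1` `]-oo, p].
  pose J1 := J (size ms) @^-1` [set true].
  (* [C0] is the case of no jump and [C1] that of an upward jump; together they are what remains of
     [B]&[S m] when success at this step is removed. *)
  pose C0 := B `&` S m `&` ~` Up.
  pose C1 := B `&` S m `&` (Up `&` ~` J1).
  have pBS : past_events U J (size ms) (B `&` S m) by exact: past_eventsI.
  have pBS1 : past_events U J (size ms).+1 (B `&` S m).
    exact: past_events_sub pBS.
  have pUp : past_events U J (size ms).+1 Up by exact: past_events_U.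
  have pJ1 : past_events U J (size ms).+1 J1 by exact: past_events_J.
  have pC0 : past_events U J (size ms).+1 C0.
    by apply: past_eventsI => //; exact: past_eventsC.
  have pC1 : past_events U J (size ms).+1 C1.
    by do 2?apply: past_eventsI => //; exact: past_eventsC.
  have mC0 := past_events_measurable pC0.
  have mC1 := past_events_measurable pC1.
  have size_m : (n < (size (rcons ms m) + k).*2)%N by rewrite size_rcons addSnnS.
  have BSB : B `&` S m `<=` B by move=> w [].
  have BS_run w : (B `&` S m) w -> running n (st w (size ms)).
    by move=> [Bw _]; exact: run_B.
  have bound_C0 : bounded_below
      (lower_bound theta n / \prod_(m' <- rcons ms m) no_success_prob theta m') C0.
    apply: (IH _ _ _ size_m valid_m).
    apply: (unsuccessful_path_step (j := false) pathB _ pC0)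
      => [w []|w []|w []|w []|//].
    - by move=> /BSB.
    - by move=> /BS_run.
    - by move=> [].
    - by move=> _ /negP; rewrite /Up /= in_itv/= => /negbTE.
  have bound_C1 : bounded_below
      (lower_bound theta n / \prod_(m' <- rcons ms m) no_success_prob theta m') C1.
    apply: (IH _ _ _ size_m valid_m).
    apply: (unsuccessful_path_step (j := true) pathB _ pC1)
      => [w []|w []|w []|w []|w []].
    - by move=> /BSB.
    - by move=> /BS_run.
    - by move=> [].
    - by move=> _ []; rewrite /Up /= in_itv/= => ->.
    - by move=> _ [_ /negP].
  have C01 : C0 `&` C1 = set0.
    by apply/seteqP; split=> // w [[_ nUp] [_ [Upw _]]].
  have [mCF PCF] := bounded_belowU mC0 mC1 C01 bound_C0 bound_C1.
  have CE : C0 `|` C1 = (B `&` S m) `\` (Up `&` J1).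
    rewrite /C0 /C1 -setIUr setDE setCI; congr (_ `&` _).
    apply/seteqP; split=> w /=; first by case=> [|[]]; [left|right].
    by have [Upw [//|nJ]|nUp _] := pselect (Up w); [right|left].
  have CF : B `&` S m `&` F = (C0 `|` C1) `&` F.
    rewrite CE; apply/seteqP; split=> w [BSw Fw]; split=> //; last by case: BSw.
    split=> // -[/= Upw Jw]; have := Fw (size ms) (BS_run _ BSw).
    rewrite -/(st w _) (stB w (BSB _ BSw)) /jumps /= BSw.2.
    by move: Upw; rewrite /Up /= in_itv/= => ->; rewrite Jw.
  have p01 : 0 <= p <= 1 by rewrite jump_prob_ge0//= jump_prob_le1.
  have q_gt0 : 0 < no_success_prob theta m by exact: no_success_prob_gt0.
  (* Going back one step releases the factor of [m], which is what [no_success_step] loses. *)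
  have cE : c = no_success_prob theta m *
      (lower_bound theta n / \prod_(m' <- rcons ms m) no_success_prob theta m').
    rewrite big_rcons/= /c; field.
    by rewrite !gt_eqF ?prod_gt0.
  rewrite /bounded_below CF; split => //; apply: le_trans PCF.
  rewrite cE EFinM muleA CE lee_wpmul2r//; last first.
    exact: no_success_step pBS p01.
  by rewrite lee_fin divr_ge0 ?ltW ?prod_gt0 ?lower_bound_gt0.
(* Suitable pairs have entries at most [n], so [B] splits into finitely many disjoint parts, one for
   each selected pair; the bounds are added over this list. *)
pose s := allpairs pair (iota 0 n.+1) (iota 0 n.+1).
have -> : B = B `&` [set w | rule (variates_history ms w) \in s].
  apply/esym/setIidPl => w Bw /=.
  have /and5P[_ m12 m2n _ _] := st_rule w Bw.
  rewrite [rule _]surjective_pairing allpairs_f// mem_iota/= ltnS//.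
  exact: leq_trans (ltnW m12) m2n.
have : uniq s by apply: allpairs_uniq; rewrite ?iota_uniq// => -[? ?] [? ?].
pose BS (s' : seq (nat * nat)) := B `&` [set w | rule (variates_history ms w) \in s'].
rewrite -/(BS s) => uniq_s; suff [] : measurable (BS s) /\ bounded_below c (BS s) by [].
elim: s uniq_s => [_|m s IHs /andP[m_new /IHs[mBs bound_s]]].
  rewrite (_ : BS [::] = set0); first by split=> //; exact: bounded_below0.
  by apply/seteqP; split=> w // [].
have -> : BS (m :: s) = (B `&` S m) `|` BS s.
  rewrite -setIUr; congr (_ `&` _); apply/seteqP; split=> w /=; rewrite inE.
    by move=> /orP[/eqP|]; [left|right].
  by case=> [->|->]; rewrite ?eqxx ?orbT.
have mBSm : measurable (B `&` S m).
  by apply: measurableI => //; exact: past_events_measurable (pS m).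
split; first exact: measurableU.
apply: bounded_belowU => //.
by apply/seteqP; split=> // w [[_ Sw] [_ /=]]; rewrite Sw (negbTE m_new).
Qed.

Lemma lower_bound_le_unsuccessful : ((lower_bound theta n)%:E <= P F)%E.
Proof.
have [] := @unsuccessful_path_bound n.+1 [::] 0 setT.
- by rewrite add0n; lia.
- by [].
- split=> //; exact: past_eventsT.
- by rewrite setTI big_nil divr1 probability_setT mul1e.
Qed.

End Coupling.

Theorem theorem2p1 (R : realType) (theta : R) (theta_gt0 : 0 < theta) :
  (forall (n : nat) (d : measure_display) (T : measurableType d)
      (P : probability T R) (U : nat -> {RV P >-> R})
      (J : nat -> {RV P >-> bool}) (rule : history R -> nat * nat),
    pairing_coupling theta n U J rule ->
    ((lower_bound theta n)%:E <= P (unsuccessful theta n U J rule))%E)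
  /\ asymp (lower_bound theta) (fun n : nat => n%:R `^ (- theta / 2)).
Proof.
split; last exact: asymp_lower_bound.
by move=> n d T P U J rule; exact: lower_bound_le_unsuccessful.
Qed.
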